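(* Consider an MTDC network with $n$ buses described by $$C_i \dot V_i = -\sum_{j\in\mathcal N_i}\frac{1}{R_{ij}}(V_i-V_j) + I_i^{\text{inj}} + u_i,\qquad i=1,\dots,n,$$ where the injected currents $I^{\text{inj}}$ are constant and the control input $u$ is given by distributed averaging controller III, in vector form $$u=-K^P(V-\hat V-\bar V),\qquad \dot{\hat V}=-\gamma\mathcal L_c(\hat V+\bar V-V),\qquad \dot{\bar V}=-K^V(V-V^{\text{nom}})-\delta\mathcal L_c\bar V .$$ Let $$A=\begin{bmatrix}-\delta\mathcal L_c & 0_{n\times n} & -K^V\\ -\gamma\mathcal L_c & -\gamma\mathcal L_c & \gamma\mathcal L_c\\ EK^P & EK^P & -E(\mathcal L_R+K^P)\end{bmatrix}$$ be the system matrix of the closed-loop dynamics in the state $(\bar V,\hat V,V)$. If all eigenvalues of $A$, except the one eigenvalue which always equals $0$, lie in the open left half plane $\mathbb C^-$, and if $K^P=F^{-1}$ and $K^V=G$, where $F=\operatorname{diag}(f_1,\dots,f_n)$ and $G=\operatorname{diag}(g_1,\dots,g_n)$, then Objective 1 (defined in the context) is satisfied given any non-negative constants $g_i$, $i=1,\dots,n$.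
   Context: MTDC network: a connected undirected graph with vertex set $\mathcal V=\{1,\dots,n\}$ (buses) and edges (HVDC lines); $\mathcal N_i$ is the set of neighbours of $i$; each line $\{i,j\}$ has resistance $R_{ij}=R_{ji}>0$; $C_i>0$ is the capacitance of bus $i$, $E=\operatorname{diag}(C_1^{-1},\dots,C_n^{-1})$; $V_i(t)\in\mathbb R$ is the voltage of bus $i$; $I_i^{\text{inj}}\in\mathbb R$ is a constant injected current; $u_i$ is the controlled injected current; $V^{\text{nom}}=[V_1^{\text{nom}},\dots,V_n^{\text{nom}}]^T$ is the constant vector of nominal voltages. $\mathcal L_R$ is the weighted Laplacian of the network graph with edge weights $1/R_{ij}$. $\mathcal L_c$ is the weighted Laplacian of a connected undirected communication graph on $\mathcal V$ with edge weights $c_{ij}=c_{ji}>0$. The controller parameters are constants $\gamma,\delta>0$ and diagonal matrices $K^P=\operatorname{diag}(K_1^P,\dots,K_n^P)$ (with $K_i^P>0$) and $K^V=\operatorname{diag}(K_1^V,\dots,K_n^V)$. The matrix $A$ always has an eigenvalue $0$ (with right eigenvector $[1_n^T,-1_n^T,0_n^T]^T$); the hypothesis means that, counted with multiplicity, exactly one eigenvalue is $0$ and the other $3n-1$ lie in $\mathbb C^-$. Objective 1: let $f_i>0$ and $g_i\ge 0$, $i=1,\dots,n$, be given constants. Consider the problem of minimizing $\sum_{i=1}^n \frac12 f_i u_i^2$ over $(u,V)\in\mathbb R^n\times\mathbb R^n$ subject to $\mathcal L_R V = I^{\text{inj}}+u$. Let $u^*$ be the (unique) optimal $u$ and $V^*$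 the set of all optimal $V$ (i.e. all $V$ with $\mathcal L_R V=I^{\text{inj}}+u^*$). Objective 1 is satisfied if $\lim_{t\to\infty}u(t)=u^*$ and the asymptotic voltages minimize $\sum_{i=1}^n \frac12 g_i(V_i^{\text{nom}}-V_i)^2$ over $V\in V^*$. *)

(* Defs.v *)
From HB Require Import structures.
From mathcomp Require Export all_boot all_order all_algebra.
From mathcomp Require Export all_classical all_reals all_analysis.
From mathcomp.real_closed Require Export complex.
Export Order.TTheory GRing.Theory Num.Theory numFieldNormedType.Exports.

Set Implicit Arguments.
Unset Strict Implicit.
Unset Printing Implicit Defensive.

Local Open Scope classical_set_scope.
Local Open Scope ring_scope.

Definition connected_simple_graph (n : nat) (e : rel 'I_n) : Prop :=
  [/\ symmetric e, irreflexive e & forall i j : 'I_n, connect e i j].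

Definition positive_edge_weights (R : realType) (n : nat) (e : rel 'I_n)
    (w : 'I_n -> 'I_n -> R) : Prop :=
  forall i j : 'I_n, e i j -> 0 < w i j /\ w i j = w j i.

(* The values of [w] outside the edge set are ignored. *)
Definition laplacian (R : realType) (n : nat) (e : rel 'I_n)
    (w : 'I_n -> 'I_n -> R) : 'M[R]_n :=
  \matrix_(i, j) if i == j then \sum_(k | e i k) w i k
                 else if e i j then - w i j else 0.

Definition diagm (R : realType) (n : nat) (d : 'I_n -> R) : 'M[R]_n :=
  diag_mx (\row_i d i).

(* The differential equations are required only at the times t > 0, so every
   solution on [0, +oo[ qualifies, whatever the initial condition. *)
Definition mtdc_dynamics (R : realType) (n : nat) (e : rel 'I_n)
    (r : 'I_n -> 'I_n -> R) (C : 'I_n -> R) (Iinj : 'cV[R]_n)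
    (u V : R -> 'cV[R]_n) : Prop :=
  forall t : R, 0 < t ->
    derivable V t 1 /\
    forall i : 'I_n,
      C i * (derive1 V t) i 0 =
        - (\sum_(j | e i j) (r i j)^-1 * (V t i 0 - V t j 0))
        + Iinj i 0 + u t i 0.

(* [Vh] and [Vb] are the controller states \hat V and \bar V. *)
Definition controller_III (R : realType) (n : nat) (Lc KP KV : 'M[R]_n)
    (gamma delta : R) (Vnom : 'cV[R]_n) (u V Vh Vb : R -> 'cV[R]_n) : Prop :=
  forall t : R, 0 < t ->
    [/\ u t = - (KP *m (V t - Vh t - Vb t)),
        is_derive t 1 Vh (- gamma *: (Lc *m (Vh t + Vb t - V t))) &
        is_derive t 1 Vb (- (KV *m (V t - Vnom)) - delta *: (Lc *m Vb t))].

(* State ordering (\bar V, \hat V, V). *)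
Definition system_matrix (R : realType) (n : nat) (LR Lc E KP KV : 'M[R]_n)
    (gamma delta : R) : 'M[R]_(n + (n + n)) :=
  block_mx
    (- delta *: Lc)                            (row_mx 0 (- KV))
    (col_mx (- gamma *: Lc) (E *m KP))
      (block_mx (- gamma *: Lc) (gamma *: Lc)
                (E *m KP)       (- (E *m (LR + KP)))).

(* 0 is a root of the characteristic polynomial of algebraic multiplicity
   exactly one, and all other complex eigenvalues have negative real part. *)
Definition stable_but_simple_zero (R : realType) (m : nat) (A : 'M[R]_m)
    : Prop :=
  let AC := map_mx (real_complex R) A in
  mup 0 (char_poly AC) = 1%N /\
  forall z : R[i], eigenvalue AC z -> z != 0 -> complex.Re z < 0.

Definition optimal_pair (R : realType) (n : nat) (LR : 'M[R]_n)
    (Iinj : 'cV[R]_n) (f : 'I_n -> R) (u V : 'cV[R]_n) : Prop :=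
  LR *m V = Iinj + u /\
  forall u' V' : 'cV[R]_n, LR *m V' = Iinj + u' ->
    \sum_i 2^-1 * f i * u i 0 ^+ 2 <= \sum_i 2^-1 * f i * u' i 0 ^+ 2.

Definition voltage_deviation (R : realType) (n : nat) (g : 'I_n -> R)
    (Vnom V : 'cV[R]_n) : R :=
  \sum_i 2^-1 * g i * (Vnom i 0 - V i 0) ^+ 2.

(* [us] is the unique optimal current u^*, so that the set V^* of optimal
   voltages is [set W | optimal_pair LR Iinj f us W]; [Vinf] is the vector of
   asymptotic voltages, whose existence is part of the objective. *)
Definition objective1 (R : realType) (n : nat) (LR : 'M[R]_n)
    (Iinj Vnom : 'cV[R]_n) (f g : 'I_n -> R) (u V : R -> 'cV[R]_n) : Prop :=
  exists us Vinf : 'cV[R]_n,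
    [/\ unique (fun v => exists W, optimal_pair LR Iinj f v W) us,
        u t @[t --> +oo] --> us,
        V t @[t --> +oo] --> Vinf,
        optimal_pair LR Iinj f us Vinf &
        forall W : 'cV[R]_n, optimal_pair LR Iinj f us W ->
          voltage_deviation g Vnom Vinf <= voltage_deviation g Vnom W].

(* Main.v *)
Require Import Defs.
From mathcomp Require Import ring lra.

(* The state x = (Vb, Vh, V) solves x' = A x + b.  Every left null vector of A
   is of the form (0, w, 0), hence orthogonal to b, so an equilibrium x* exists
   and y = x - x* solves y' = A y.  The spectral hypothesis and Cayley-Hamilton
   give A y -> 0: over the complex numbers, the characteristic polynomial is
   X times factors X - z with Re z < 0, and a solution of w' - z w = h with
   h -> 0 tends to 0.  The functionals V and Vb + Vh vanish on the kernel of A,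
   so they factor through A and converge along y to 0; this determines the
   limits of V and u.  At the equilibrium, f_i u_i does not depend on i and
   the sum of the g_i (V_i - Vnom_i) is 0, which are the optimality conditions
   of the two minimization problems. *)

Set Implicit Arguments.
Unset Strict Implicit.
Unset Printing Implicit Defensive.

Local Open Scope classical_set_scope.
Local Open Scope ring_scope.

(** * Decay of solutions of scalar differential inequalities *)

(** Grönwall argument: once [k] stays below [- al * (eps / 2)], the function
    [(N t - eps / 2) * expR (- al * t)] is nonincreasing, so [N] exceeds [eps / 2] by at most an
    exponentially decaying term. *)
Lemma cvg0_of_derive_le (R : realType) (al : R) (N dN k : R -> R) :
  al < 0 -> (forall t, 0 <= N t) ->
  (forall t : R, 0 < t -> is_derive t 1 N (dN t)) ->
  (forall t : R, 0 < t -> dN t <= al * N t + k t) ->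
  k t @[t --> +oo] --> 0 -> N t @[t --> +oo] --> 0.
Proof.
move=> al0 N0 dN_ le_dN k0; apply/cvgrPdist_lt => eps eps0.
have eta0 : 0 < - al * (eps / 2) by rewrite mulr_gt0 ?oppr_gt0 ?divr_gt0.
have [M [_ kM]] : \forall t \near +oo, `|0 - k t| < - al * (eps / 2).
  by move/cvgrPdist_lt: k0; apply.
(* Beyond [T] both the differential inequality, which needs positive times, and the smallness of
   [k], which needs times above [M], are available. *)
pose T := Num.max M 0 + 1.
have T0 : 0 < T by rewrite ltr_wpDl// le_max lexx orbT.
have MT : M < T by rewrite ltr_pwDr// le_max lexx.
pose g t := (N t - eps / 2) * expR (- al * t).
pose dg t := (dN t - al * N t + al * (eps / 2)) * expR (- al * t).
have dg_ (t : R) : 0 < t -> is_derive t 1 g (dg t).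
  move=> t0; have := dN_ _ t0 => ?; rewrite /g.
  apply: is_derive_eq.
  rewrite /dg /= /GRing.scale /=; ring.
have g_le (t : R) : T <= t -> g t <= g T.
  move=> Tt; apply: (@ler0_derive1_nincry _ g T) => //.
  - move=> x; rewrite in_itv/= andbT => Tx; have := dg_ x (lt_trans T0 Tx).
    by case.
  - move=> x; rewrite in_itv/= andbT => Tx; have x0 := lt_trans T0 Tx.
    have [_] := dg_ x x0; rewrite derive1E => ->.
    rewrite /dg pmulr_lle0 ?expR_gt0//.
    have := kM x (lt_trans MT Tx); have := le_dN x x0.
    rewrite sub0r normrN => h1; move/(le_lt_trans (ler_norm _)); lra.
  - apply: derivable_within_continuous => x; rewrite in_itv/= andbT => Tx.
    by have := dg_ x (lt_le_trans T0 Tx); case.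
have E0 : expR (- ((- al) * t)) @[t --> +oo] --> (0 : R).
  apply: (cvg_comp _ _ _ (@cvgr_expR R)).
  apply: gt0_cvgMry; last exact: cvg_id.
  by rewrite oppr_gt0.
have gE0 : g T * expR (- ((- al) * t)) @[t --> +oo] --> (0 : R).
  by rewrite -[0 in X in _ --> X](mulr0 (g T)); apply: cvgM => //; exact: cvg_cst.
move/cvgrPdist_lt : gE0 => /(_ (eps / 2)) /[!divr_gt0]// /(_ isT) gE0.
near=> t.
rewrite sub0r normrN ger0_norm//.
have : `|0 - g T * expR (- (- al * t))| < eps / 2 by near: t.
rewrite sub0r normrN => /(le_lt_trans (ler_norm _)).
  have Tt : T <= t by near: t; apply: nbhs_pinfty_ge; rewrite num_real.
have := g_le t Tt.
have e0 := expR_gt0 (- al * t).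
rewrite -(ler_pM2r (expR_gt0 (- (- al * t)))) {1}/g -mulrA -expRD subrr expR0 mulr1.
lra.
Unshelve. all: by end_near. Qed.

(* This is the complex equation w' = lam w + h read on w = a + ib. *)
Lemma cvg0_of_rotation_decay (R : realType) (al be : R) (a b h k : R -> R) :
  al < 0 ->
  (forall t : R, 0 < t -> is_derive t 1 a (al * a t - be * b t + h t)) ->
  (forall t : R, 0 < t -> is_derive t 1 b (be * a t + al * b t + k t)) ->
  h t @[t --> +oo] --> 0 -> k t @[t --> +oo] --> 0 ->
  a t @[t --> +oo] --> 0 /\ b t @[t --> +oo] --> 0.
Proof.
move=> al0 da db h0 k0.
pose N t := a t * a t + b t * b t.
have N0 : N t @[t --> +oo] --> 0.
  (* Here [N] is the squared modulus of [w], with natural decay rate [2 * al]. Half of this rate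
     absorbs the cross terms with [h] and [k]: the slack is a sum of two squares divided by
     [- al]. *)
  apply: (@cvg0_of_derive_le _ al N
    (fun t => 2 * al * N t + 2 * (a t * h t + b t * k t))
    (fun t => (h t * h t + k t * k t) / - al)) => //.
  - by move=> t; rewrite addr_ge0// -expr2 sqr_ge0.
  - move=> t t0; have := da t t0; have := db t t0 => ? ?.
    by apply: is_derive_eq; rewrite /N /= /GRing.scale /=; ring.
  - move=> t _; rewrite -subr_ge0.
    suff -> : al * N t + (h t * h t + k t * k t) / - al
      - (2 * al * N t + 2 * (a t * h t + b t * k t))
      = ((al * a t + h t) ^+ 2 + (al * b t + k t) ^+ 2) / - al.
      by rewrite divr_ge0 ?addr_ge0 ?sqr_ge0// oppr_ge0 ltW.
    by rewrite /N; field; rewrite lt_eqF.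
  - rewrite -[0 in X in _ --> X](mul0r (- al)^-1); apply: cvgM; last exact: cvg_cst.
    have := cvgD (cvgM h0 h0) (cvgM k0 k0).
    rewrite !mulr0 addr0. exact.
move/cvgrPdist_lt : N0 => N0.
split; apply/cvgrPdist_lt => eps eps0; near=> t;
  (have : `|0 - N t| < eps ^+ 2 by near: t; apply: N0; rewrite exprn_gt0);
  rewrite !sub0r !normrN => /(le_lt_trans (ler_norm _)) lt_N;
  rewrite -(ltr_pXn2r (n := 2)) ?nnegrE ?normr_ge0 ?(ltW eps0)//;
  rewrite real_normK ?num_real//;
  apply: le_lt_trans lt_N; rewrite /N expr2.
  by rewrite lerDl -expr2 sqr_ge0.
by rewrite lerDr -expr2 sqr_ge0.
Unshelve. all: by end_near. Qed.

(** * Complex linear functionals of a real linear flow *)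

Lemma is_derive_mulmx_row (R : realType) (m : nat) (y : R -> 'cV[R]_m)
    (dy : 'cV[R]_m) (t : R) (rho : 'rV[R]_m) :
  (forall i, is_derive t 1 (fun s => y s i 0) (dy i 0)) ->
  is_derive t 1 (fun s => (rho *m y s) 0 0) ((rho *m dy) 0 0).
Proof.
move=> dy_.
have -> : (fun s => (rho *m y s) 0 0) = \sum_i (fun s => rho 0 i *: (y s i 0 : R)).
  by apply/funext => s; rewrite mxE fct_sumE.
rewrite mxE; apply: is_derive_sum => i.
Qed.

(** Meant for [h] the real or the imaginary part, both additive and compatible with real factors. *)
Lemma map_mulmx_real (R : realType) (m n : nat) (h : R[i] -> R)
    (l : 'rV[R[i]]_m) (A : 'M[R]_(m, n)) :
  {morph h : x y / x + y} -> (forall z k, h (z * (real_complex R k)) = h z * k) ->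
  map_mx h (l *m map_mx (real_complex R) A) = map_mx h l *m A.
Proof.
move=> hD hZ; apply/matrixP => i j; rewrite !mxE (big_morph h hD (id1 := 0)).
  by apply: eq_bigr => k _; rewrite !mxE hZ.
by rewrite -[0 in LHS](mul0r (real_complex R 0)) hZ mulr0.
Qed.

Lemma map_Re_mulmx_real (R : realType) (m n : nat) (l : 'rV[R[i]]_m)
    (A : 'M[R]_(m, n)) :
  map_mx (@complex.Re R) (l *m map_mx (real_complex R) A)
    = map_mx (@complex.Re R) l *m A.
Proof.
by apply: map_mulmx_real => [[? ?] []|[p q] k] //=; rewrite mulr0 subr0.
Qed.

Lemma map_Im_mulmx_real (R : realType) (m n : nat) (l : 'rV[R[i]]_m)
    (A : 'M[R]_(m, n)) :
  map_mx (@complex.Im R) (l *m map_mx (real_complex R) A)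
    = map_mx (@complex.Im R) l *m A.
Proof.
by apply: map_mulmx_real => [[? ?] []|[p q] k] //=; rewrite mulr0 add0r.
Qed.

(* The complex function l y of a real trajectory y tends to 0. *)
Definition cfunctional_cvg0 (R : realType) (m : nat) (y : R -> 'cV[R]_m)
    (l : 'rV[R[i]]_m) : Prop :=
  (map_mx (@complex.Re R) l *m y t) 0 0 @[t --> +oo] --> (0 : R) /\
  (map_mx (@complex.Im R) l *m y t) 0 0 @[t --> +oo] --> (0 : R).

(** The function [w = l y] satisfies [w' = z w + l (A - z) y], whose forcing term tends to 0 by
    hypothesis; real and imaginary parts then fall under the rotation estimate. *)
Lemma cfunctional_cvg0_step (R : realType) (m : nat) (A : 'M[R]_m)
    (y : R -> 'cV[R]_m) (l : 'rV[R[i]]_m) (z : R[i]) :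
  (forall t : R, 0 < t ->
     forall i, is_derive t 1 (fun s => y s i 0) ((A *m y t) i 0)) ->
  complex.Re z < 0 ->
  cfunctional_cvg0 y (l *m (map_mx (real_complex R) A - z%:M)) ->
  cfunctional_cvg0 y l.
Proof.
move=> dy z0 [hR hI].
set a := (fun t => (map_mx (@complex.Re R) l *m y t) 0 0).
set b := (fun t => (map_mx (@complex.Im R) l *m y t) 0 0).
have eR t : ((map_mx (@complex.Re R) l *m (A *m y t)) 0 0 =
   complex.Re z * a t - complex.Im z * b t +
   (map_mx (@complex.Re R) (l *m (map_mx (real_complex R) A - z%:M)) *m y t) 0 0).
  rewrite mulmxBr mul_mx_scalar.
  have -> : map_mx (@complex.Re R) (l *m map_mx (real_complex R) A - z *: l)
    = map_mx (@complex.Re R) l *m A - (complex.Re z *: map_mx (@complex.Re R) l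
        - complex.Im z *: map_mx (@complex.Im R) l).
    rewrite -map_Re_mulmx_real; apply/matrixP => i j; rewrite !mxE.
    by case: (\sum_ _ _) => ? ?; case: z {z0 hR hI} => ? ?; case: (l i j).
  rewrite /a /b mulmxBl mulmxBl -!scalemxAl mulmxA !mxE.
  ring.
have eI t : ((map_mx (@complex.Im R) l *m (A *m y t)) 0 0 =
   complex.Im z * a t + complex.Re z * b t +
   (map_mx (@complex.Im R) (l *m (map_mx (real_complex R) A - z%:M)) *m y t) 0 0).
  rewrite mulmxBr mul_mx_scalar.
  have -> : map_mx (@complex.Im R) (l *m map_mx (real_complex R) A - z *: l)
    = map_mx (@complex.Im R) l *m A - (complex.Im z *: map_mx (@complex.Re R) l
        + complex.Re z *: map_mx (@complex.Im R) l).
    rewrite -map_Im_mulmx_real; apply/matrixP => i j; rewrite !mxE.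
    case: (\sum_ _ _) => ? ?; case: z {z0 hR hI eR} => ? ?; case: (l i j) => ? ? /=.
    by rewrite [X in _ - X]addrC.
  rewrite /a /b mulmxBl mulmxDl -!scalemxAl mulmxA !mxE.
  ring.
apply: (cvg0_of_rotation_decay z0 (be := complex.Im z) _ _ hR hI) => t t0.
- rewrite -eR; apply: is_derive_mulmx_row => i; exact: dy.
- rewrite -eI; apply: is_derive_mulmx_row => i; exact: dy.
Qed.

(** Each factor [A - z] is moved from the product onto [l]; when none is left, [l] itself is 0, and
    the decay is carried back one factor at a time. *)
Lemma cfunctional_cvg0_prod (R : realType) (m : nat) (A : 'M[R]_m.+1)
    (y : R -> 'cV[R]_m.+1) (zs : seq R[i]) (l : 'rV[R[i]]_m.+1) :
  (forall t : R, 0 < t ->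
     forall i, is_derive t 1 (fun s => y s i 0) ((A *m y t) i 0)) ->
  (forall z, z \in zs -> complex.Re z < 0) ->
  l *m (\prod_(z <- zs) (map_mx (real_complex R) A - z%:M)) = 0 ->
  cfunctional_cvg0 y l.
Proof.
move=> dy; elim: zs l => [|z zs IH] l zs0.
  rewrite big_nil mulmx1 => ->; split;
  rewrite (_ : (fun t => _) = (fun=> 0)); try exact: cvg_cst;
  apply/funext => t; rewrite (_ : map_mx _ _ = 0) ?mul0mx ?mxE//;
  by apply/matrixP => i j; rewrite !mxE.
rewrite big_cons -mulmxE mulmxA => l0.
apply: (cfunctional_cvg0_step dy (z := z)).
  by rewrite zs0// mem_head.
by apply: IH => // z' zz'; rewrite zs0// in_cons zz' orbT.
Qed.

(** The factor X of the characteristic polynomial has no decay of its own. It is kept as the factor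
    [A] in front of [y], and Cayley-Hamilton says that the remaining stable factors annihilate
    [rho A]. *)
Lemma stable_but_simple_zero_cvg0 (R : realType) (m : nat) (A : 'M[R]_m)
    (y : R -> 'cV[R]_m) (rho : 'rV[R]_m) :
  stable_but_simple_zero A ->
  (forall t : R, 0 < t ->
     forall i, is_derive t 1 (fun s => y s i 0) ((A *m y t) i 0)) ->
  (rho *m (A *m y t)) 0 0 @[t --> +oo] --> 0.
Proof.
(* The product of factors [A - z] is handled in positive dimension only; in dimension 0 the
   functional is identically 0. *)
case: m => [|m] in A y rho *.
  move=> _ _; rewrite (_ : (fun t => _) = (fun=> 0)); first exact: cvg_cst.
  by apply/funext => t; rewrite [rho]thinmx0 mul0mx mxE.
set AC := map_mx (real_complex R) A.
move=> [mup1 eigA] dy.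
have [zs] := closed_field_poly_normal (char_poly AC).
rewrite (monicP (char_poly_monic AC)) scale1r => chA.
move: mup1; rewrite -/AC chA mu_prod_XsubC => cnt1.
have zs0 : 0 \in zs by rewrite -has_pred1 has_count cnt1.
(* Since 0 occurs exactly once among the roots, removing one copy leaves only roots with negative
   real part. *)
have pzs := perm_to_rem zs0.
have nz : 0 \notin rem 0 zs.
  apply/count_memPn; move/permP/(_ (pred1 0)): pzs.
  by rewrite cnt1 /= eqxx => -[].
have CH : AC *m \prod_(z <- rem 0 zs) (AC - z%:M) = 0.
  have := Cayley_Hamilton AC.
  rewrite chA (perm_big _ pzs) big_cons/= subr0 rmorphM/= horner_mx_X => <-.
  rewrite mulmxE rmorph_prod; congr (_ * _); apply: eq_bigr => z _.
  by rewrite rmorphB/= horner_mx_X horner_mx_C.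
have [] := @cfunctional_cvg0_prod R m A y (rem 0 zs)
  (map_mx (real_complex R) rho *m AC) dy.
- move=> z zin; apply: eigA; last by apply/eqP => zz; rewrite zz (negbTE nz) in zin.
  rewrite eigenvalue_root_char -/AC chA root_prod_XsubC.
  exact: (mem_rem zin).
- by rewrite -mulmxA CH mulmx0.
move=> + _; rewrite map_Re_mulmx_real.
have -> : map_mx (@complex.Re R) (map_mx (real_complex R) rho) = rho.
  by apply/matrixP => i j; rewrite !mxE.
by under eq_cvg do rewrite -mulmxA.
Qed.

(** * Linear systems and multiplicity of the eigenvalue 0 *)

(** The columns of [cokermx A] lie in the kernel of [A], so [P] kills them, which is the criterion
    for the row space of [P] to lie in that of [A]. *)
Lemma mulmx_factor_of_ker (F : fieldType) (m n p : nat)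
    (A : 'M[F]_(m, n)) (P : 'M[F]_(p, n)) :
  (forall x : 'cV[F]_n, A *m x = 0 -> P *m x = 0) ->
  exists Q : 'M[F]_(p, m), P = Q *m A.
Proof.
move=> kerAP; apply/submxP; rewrite submxE; apply/eqP/matrixP => i j.
have : P *m col j (cokermx A) = 0.
  by apply: kerAP; rewrite colE mulmxA mulmx_coker mul0mx.
by rewrite colE mulmxA -colE => /matrixP/(_ i 0); rewrite [LHS]mxE => ->; rewrite !mxE.
Qed.

(** Fredholm alternative, obtained from the factorization lemma by transposition. *)
Lemma mulmx_solvable (F : fieldType) (m n : nat)
    (A : 'M[F]_(m, n)) (b : 'cV[F]_m) :
  (forall w : 'rV[F]_m, w *m A = 0 -> w *m b = 0) ->
  exists x : 'cV[F]_n, A *m x = b.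
Proof.
move=> kerAb; have [|q bq] := @mulmx_factor_of_ker F n m 1 A^T b^T.
  move=> x Ax; apply: trmx_inj; rewrite trmx_mul trmxK trmx0; apply: kerAb.
  by apply: trmx_inj; rewrite trmx_mul trmxK Ax trmx0.
by exists q^T; apply: trmx_inj; rewrite trmx_mul trmxK.
Qed.

Lemma char_poly_lblock (F : comNzRingType) (m n : nat) (A : 'M[F]_m)
    (B : 'M[F]_(n, m)) (D : 'M[F]_n) :
  char_poly (block_mx A 0 B D) = char_poly A * char_poly D.
Proof.
rewrite /char_poly /char_poly_mx map_block_mx map_mx0 scalar_mx_block.
by rewrite opp_block_mx add_block_mx subr0 det_lblock.
Qed.

Lemma mup0_char_poly_gt0 (R : realType) (m : nat) (A : 'M[R]_m)
    (w : 'rV[R]_m) :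
  w != 0 -> w *m A = 0 ->
  (0 < mup 0 (char_poly (map_mx (real_complex R) A)))%N.
Proof.
move=> w0 wA; rewrite -XsubC_dvd ?monic_neq0 ?char_poly_monic//.
rewrite dvdp_XsubCl -eigenvalue_root_char; apply/eigenvalueP.
exists (map_mx (real_complex R) w); last by rewrite map_mx_eq0.
by rewrite -map_mxM wA map_mx0 scale0r.
Qed.

(** In dimension 0 there is no nonzero eigenvector, so 0 cannot be a root. This is how the network
    is seen to have at least one bus. *)
Lemma stable_but_simple_zero_gt0 (R : realType) (m : nat) (A : 'M[R]_m) :
  stable_but_simple_zero A -> (0 < m)%N.
Proof.
case: m A => // A [mup1 _].
suff : (0 < mup 0 (char_poly (map_mx (real_complex R) A)))%N.
  rewrite -XsubC_dvd ?monic_neq0 ?char_poly_monic// dvdp_XsubCl.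
  by rewrite -eigenvalue_root_char => /eigenvalueP[v _]; rewrite [v]thinmx0 eqxx.
by rewrite mup1.
Qed.

(** * Entrywise limits and derivatives of matrix functions *)

Lemma cvg_mx (R : realFieldType) (T : Type) (F : set_system T) (FF : Filter F)
    (m n : nat) (M : T -> 'M[R]_(m, n)) (L : 'M[R]_(m, n)) :
  (forall i j, M t i j @[t --> F] --> L i j) -> M t @[t --> F] --> L.
Proof.
move=> ML; apply/cvgrPdist_le => /= eps eps0; near=> t.
rewrite /Num.Def.normr/= mx_normrE (bigmax_le _ (ltW eps0))//= => i _.
rewrite !mxE; move: i; near: t; apply: filter_forall => /= i.
by move/cvgrPdist_le : (ML i.1 i.2); apply.
Unshelve. all: by end_near. Qed.

Lemma is_derive_coord (R : realFieldType) (m n : nat) (M : R -> 'M[R]_(m, n))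
    (t : R) (dM : 'M[R]_(m, n)) (i : 'I_m) (j : 'I_n) :
  is_derive t 1 M dM -> is_derive t 1 (fun s => M s i j) (dM i j).
Proof.
case=> Mt <-; rewrite derive_mx// mxE.
by apply: DeriveDef => //; move/derivable_mxP : Mt; apply.
Qed.

(** * Weighted Laplacian of a connected graph *)

Section laplacian.
Variables (R : realType) (n : nat) (e : rel 'I_n) (w : 'I_n -> 'I_n -> R).
Hypotheses (ce : connected_simple_graph e) (pw : positive_edge_weights e w).

Lemma laplacian_mulE (x : 'cV[R]_n) (i : 'I_n) :
  (laplacian e w *m x) i 0 = \sum_(j | e i j) w i j * (x i 0 - x j 0).
Proof.
have [_ irre _] := ce.
rewrite mxE (bigD1 i)//= !mxE eqxx.
under [X in _ = X]eq_bigr do rewrite mulrBr.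
rewrite sumrB -mulr_suml; congr (_ + _).
rewrite -sumrN [RHS]big_mkcond [LHS]big_mkcond/=; apply: eq_bigr => j _.
rewrite mxE eq_sym; case: eqVneq => [->|ij] /=.
  by rewrite irre.
by case: ifP; rewrite ?mul0r// mulNr.
Qed.

Lemma laplacian_sym : (laplacian e w)^T = laplacian e w.
Proof.
have [syme _ _] := ce.
apply/matrixP => i j; rewrite !mxE eq_sym; case: eqVneq => [->//|ij].
by rewrite syme; case: ifP => // /pw[_ ->].
Qed.

Lemma laplacian_mul_const (a : R) : laplacian e w *m const_mx a = 0 :> 'cV_n.
Proof.
apply/matrixP => i j; rewrite ord1 laplacian_mulE [RHS]mxE big1// => k _.
by rewrite !mxE subrr mulr0.
Qed.

Lemma const_mul_laplacian (a : R) : const_mx a *m laplacian e w = 0 :> 'rV_n.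
Proof.
by rewrite -laplacian_sym -trmx_const -trmx_mul laplacian_mul_const trmx0.
Qed.

(** The all-ones row is a left null vector. Summing an equilibrium equation over the buses thus
    removes its Laplacian term. *)
Lemma sum_laplacian_mul (x : 'cV[R]_n) : \sum_i (laplacian e w *m x) i 0 = 0.
Proof.
have := congr1 (fun M : 'M[R]_1 => M 0 0)
  (mulmxA (const_mx 1 : 'rV_n) (laplacian e w) x).
rewrite const_mul_laplacian mul0mx /= [LHS]mxE [RHS]mxE => L0.
by rewrite -[RHS]L0; apply: eq_bigr => i _; rewrite [X in _ = X * _]mxE mul1r.
Qed.

(* The quadratic form of the Laplacian is half the weighted sum of the squares
   of the differences along the edges. *)
Lemma laplacian_ker (x : 'cV[R]_n) :
  laplacian e w *m x = 0 -> exists a, x = const_mx a.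
Proof.
have [syme _ conne] := ce.
move=> Lx.
have q0 : \sum_i \sum_(j | e i j) w i j * (x i 0 - x j 0) ^+ 2 = 0.
  have q1 : \sum_i \sum_(j | e i j) w i j * (x i 0 - x j 0) * x i 0 = 0.
    rewrite big1// => i _; rewrite -mulr_suml -laplacian_mulE Lx mxE.
    by rewrite mul0r.
  (* Exchanging the endpoints of each edge, by symmetry of [e] and of the weights, turns this sum
     into the opposite of the previous one. *)
  have q2 : \sum_i \sum_(j | e i j) w i j * (x i 0 - x j 0) * x j 0 = 0.
    rewrite -[RHS]oppr0 -[in RHS]q1 [in RHS](exchange_big_dep xpredT)//= -sumrN.
    apply: eq_bigr => i _; rewrite -sumrN.
    rewrite [RHS](eq_bigl (e i)); last by move=> j; rewrite syme.
    apply: eq_bigr => j /pw[_ ->]; ring.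
  rewrite -[RHS]subr0 -[X in _ = X - _]q1 -[X in _ = _ - X]q2 -sumrB.
  apply: eq_bigr => i _.
  by rewrite -sumrB; apply: eq_bigr => j _; ring.
have edge i j : e i j -> x i 0 = x j 0.
  move=> eij; apply/eqP; rewrite -subr_eq0 -sqrf_eq0.
  have nneg k l : e k l -> 0 <= w k l * (x k 0 - x l 0) ^+ 2.
    by move=> /pw[wkl _]; rewrite mulr_ge0 ?sqr_ge0// ltW.
  have q0i : \sum_(l | e i l) w i l * (x i 0 - x l 0) ^+ 2 = 0.
    apply: (psumr_eq0P _ q0) => // k _; apply: sumr_ge0 => l; exact: nneg.
  have /eqP : w i j * (x i 0 - x j 0) ^+ 2 = 0.
    by apply: (psumr_eq0P _ q0i) => // l; exact: nneg.
  by have [wij _] := pw eij; rewrite mulf_eq0 gt_eqF.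
(* Equality along edges propagates by induction on a path from [i] to [j]. *)
have const i j : x i 0 = x j 0.
  have /connectP[p] := conne i j.
  elim: p i => [|k p IH] i /= => [_ ->//|/andP[/edge-> pk] jk].
  exact: IH.
have [n0|n0] := posnP n.
  by exists 0; apply/matrixP => -[i lti]; have := lti; rewrite [X in (_ < X)%N]n0.
by exists (x (Ordinal n0) 0); apply/matrixP => i j; rewrite ord1 mxE.
Qed.

Lemma laplacian_ker_row (x : 'rV[R]_n) :
  x *m laplacian e w = 0 -> exists a, x = const_mx a.
Proof.
move=> xL; have [|a xa] := @laplacian_ker x^T.
  by rewrite -laplacian_sym -trmx_mul xL trmx0.
by exists a; apply: trmx_inj; rewrite xa trmx_const.
Qed.

End laplacian.

(** * Products with diagonal matrices and with the system matrix *)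

Lemma positive_edge_weightsV (R : realType) (n : nat) (e : rel 'I_n)
    (r : 'I_n -> 'I_n -> R) :
  positive_edge_weights e r ->
  positive_edge_weights e (fun i j => (r i j)^-1).
Proof. by move=> pr i j /pr[r0 <-]; rewrite invr_gt0. Qed.

Lemma diagm_mulE (R : realType) (n : nat) (d : 'I_n -> R) (x : 'cV[R]_n) i :
  (diagm d *m x) i 0 = d i * x i 0.
Proof. by rewrite /diagm mul_diag_mx !mxE. Qed.

Lemma mul_diagmE (R : realType) (n : nat) (d : 'I_n -> R) (x : 'rV[R]_n) i :
  (x *m diagm d) 0 i = x 0 i * d i.
Proof. by rewrite /diagm mul_mx_diag !mxE. Qed.

Lemma diagm_inj (R : realType) (n : nat) : injective (@diagm R n).
Proof.
move=> d d' dd; apply/funext => i.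
by have /matrixP/(_ i i) := dd; rewrite !mxE eqxx !mulr1n.
Qed.

Lemma system_matrix_mul (R : realType) (n : nat) (LR Lc E KP KV : 'M[R]_n)
    (gamma delta : R) (a b v : 'cV[R]_n) :
  system_matrix LR Lc E KP KV gamma delta *m col_mx a (col_mx b v) =
  col_mx (- delta *: (Lc *m a) - KV *m v)
    (col_mx (- gamma *: (Lc *m (a + b - v)))
            (E *m (KP *m (a + b - v) - LR *m v))).
Proof.
rewrite /system_matrix mul_block_col mul_row_col mul0mx add0r mul_col_mx.
rewrite mul_block_col add_col_mx -!scalemxAl mulNmx; congr (col_mx _ (col_mx _ _)).
  by rewrite addrA -scalerDr -mulmxDr mulmxBr scalerBr (scaleNr _ (Lc *m v)) opprK.
rewrite -!mulmxA mulNmx -mulmxA !mulmxDl !mulmxBr !mulmxDr.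
by rewrite opprD !addrA addrAC.
Qed.

Lemma mul_system_matrix (R : realType) (n : nat) (LR Lc E KP KV : 'M[R]_n)
    (gamma delta : R) (a b v : 'rV[R]_n) :
  row_mx a (row_mx b v) *m system_matrix LR Lc E KP KV gamma delta =
  row_mx (- delta *: (a *m Lc) + (v *m E *m KP - gamma *: (b *m Lc)))
    (row_mx (v *m E *m KP - gamma *: (b *m Lc))
       (- (a *m KV) + gamma *: (b *m Lc) - (v *m E *m LR + v *m E *m KP))).
Proof.
rewrite /system_matrix !mul_row_block mul_row_col mul_mx_row.
rewrite mulmx0 add_row_mx add0r !scaleNr !mulmxN -!scalemxAr !mulmxA mulmxDr.
by rewrite (addrC (- (gamma *: (b *m Lc)))) [X in row_mx _ (row_mx _ X)]addrA.
Qed.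

(** * Optimality conditions of the two minimization problems *)

(** All feasible inputs have the same total, because a Laplacian image sums to 0. With equal
    marginal costs [al], the linear term of the cost around [us] therefore vanishes, and the
    remaining quadratic term is positive definite. *)
Lemma optimal_pair_unique (R : realType) (n : nat) (e : rel 'I_n)
    (w : 'I_n -> 'I_n -> R) (Iinj us Vs : 'cV[R]_n) (f : 'I_n -> R) (al : R) :
  connected_simple_graph e -> positive_edge_weights e w ->
  (forall i, 0 < f i) -> (forall i, f i * us i 0 = al) ->
  laplacian e w *m Vs = Iinj + us ->
  optimal_pair (laplacian e w) Iinj f us Vs /\
  forall u' V', optimal_pair (laplacian e w) Iinj f u' V' -> us = u'.
Proof.
move=> ce pw f0 fus eqVs.
have sumI (u' V' : 'cV[R]_n) : laplacian e w *m V' = Iinj + u' ->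
    \sum_i u' i 0 = - \sum_i Iinj i 0.
  move=> eqV'; apply/eqP; rewrite -addr_eq0 addrC -big_split/=; apply/eqP.
  rewrite -[RHS](sum_laplacian_mul ce pw V') eqV'.
  by apply: eq_bigr => i _; rewrite mxE.
have cost (u' V' : 'cV[R]_n) : laplacian e w *m V' = Iinj + u' ->
    \sum_i 2^-1 * f i * u' i 0 ^+ 2 = \sum_i 2^-1 * f i * us i 0 ^+ 2
      + \sum_i 2^-1 * f i * (u' i 0 - us i 0) ^+ 2.
  move=> eqV'; have lin0 : \sum_i al * (u' i 0 - us i 0) = 0.
    by rewrite -mulr_sumr sumrB (sumI _ _ eqV') (sumI _ _ eqVs) subrr mulr0.
  rewrite -[RHS]addr0 -[X in _ = _ + X]lin0 -!big_split/=.
  by apply: eq_bigr => i _; rewrite -(fus i); field.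
have term_ge0 (u' : 'cV[R]_n) i : 0 <= 2^-1 * f i * (u' i 0 - us i 0) ^+ 2.
  by rewrite mulr_ge0 ?sqr_ge0// mulr_ge0 ?invr_ge0// ltW.
split.
  by split=> // u' V' eqV'; rewrite (cost _ _ eqV') lerDl sumr_ge0.
move=> u' V' [eqV' /(_ _ _ eqVs)]; rewrite (cost _ _ eqV') gerDl => le0.
have /psumr_eq0P s0 : \sum_i 2^-1 * f i * (u' i 0 - us i 0) ^+ 2 = 0.
  by apply/eqP; rewrite eq_le le0 sumr_ge0.
apply/matrixP => i j; rewrite ord1.
have /eqP := s0 (fun i _ => term_ge0 u' i) i isT.
rewrite mulf_eq0 sqrf_eq0 mulf_eq0 invr_eq0 pnatr_eq0 (gt_eqF (f0 i))//= subr_eq0.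
by move=> /eqP ->.
Qed.

(** Constant shifts are the only freedom left in the optimal voltages. The linear term in [be] is a
    multiple of the vanishing weighted sum, and the quadratic term is nonnegative. *)
Lemma voltage_deviation_shift_ge (R : realType) (n : nat) (g : 'I_n -> R)
    (Vnom Vs : 'cV[R]_n) (be : R) :
  (forall i, 0 <= g i) -> \sum_i g i * (Vs i 0 - Vnom i 0) = 0 ->
  voltage_deviation g Vnom Vs <= voltage_deviation g Vnom (Vs + const_mx be).
Proof.
move=> g0 gVs; rewrite /voltage_deviation -subr_ge0.
suff -> : \sum_i 2^-1 * g i * (Vnom i 0 - (Vs + const_mx be) i 0) ^+ 2 -
    \sum_i 2^-1 * g i * (Vnom i 0 - Vs i 0) ^+ 2 = \sum_i 2^-1 * g i * be ^+ 2.
  by apply: sumr_ge0 => i _; rewrite mulr_ge0 ?sqr_ge0// mulr_ge0 ?invr_ge0.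
have lin0 : \sum_i be * (g i * (Vs i 0 - Vnom i 0)) = 0.
  by rewrite -mulr_sumr gVs mulr0.
rewrite -[RHS]addr0 -[X in _ = _ + X]lin0 -sumrB -big_split/=.
by apply: eq_bigr => i _; rewrite !mxE; field.
Qed.

Lemma sum_mulr_eq0 (R : realType) (n : nat) (d : 'I_n -> R) (al : R) :
  0 < \sum_i d i -> \sum_i d i * al = 0 -> al = 0.
Proof.
by move=> d0 /eqP; rewrite -mulr_suml mulf_eq0 gt_eqF//= => /eqP.
Qed.

(** * Null vectors of the system matrix and existence of an equilibrium *)

Section closed_loop.
Variables (R : realType) (n : nat) (e ec : rel 'I_n) (w c : 'I_n -> 'I_n -> R)
  (E kP g : 'I_n -> R) (gamma delta : R).
Hypotheses (ce : connected_simple_graph e) (pw : positive_edge_weights e w)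
  (cec : connected_simple_graph ec) (pc : positive_edge_weights ec c)
  (E_gt0 : forall i, 0 < E i) (kP_gt0 : forall i, 0 < kP i)
  (gamma_gt0 : 0 < gamma) (delta_gt0 : 0 < delta)
  (g_ge0 : forall i, 0 <= g i).
Let LR := laplacian e w.
Let Lc := laplacian ec c.
Let A := system_matrix LR Lc (diagm E) (diagm kP) (diagm g) gamma delta.

(* If all gains vanish, [A] is block triangular and both diagonal blocks are
   singular, so 0 would be at least a double eigenvalue. *)
Lemma stable_sum_gain_gt0 : stable_but_simple_zero A -> 0 < \sum_i g i.
Proof.
move=> stA; rewrite lt_neqAle sumr_ge0// andbT; apply/eqP => g0.
have n0 : (0 < n)%N by move: (stable_but_simple_zero_gt0 stA); rewrite !addn_gt0 !orbb.
have {}g0 : diagm g = 0.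
  apply/matrixP => i j; rewrite !mxE.
  by rewrite (psumr_eq0P _ (esym g0))// mul0rn.
have one0 : const_mx 1 != 0 :> 'rV[R]_n.
  apply/eqP => /matrixP/(_ 0 (Ordinal n0)); rewrite !mxE.
  by move/eqP; rewrite oner_eq0.
(* The left null vectors are the all-ones row for the upper diagonal block and the row [(1, 0)] for
   the lower one. *)
have : (1 < mup 0 (char_poly (map_mx (real_complex R) A)))%N.
  rewrite /A /system_matrix g0 oppr0 row_mx0 map_block_mx map_mx0 char_poly_lblock.
  rewrite mupM ?monic_neq0 ?char_poly_monic// -[2%N]/(1 + 1)%N leq_add//.
    apply: (mup0_char_poly_gt0 one0).
    by rewrite -scalemxAr const_mul_laplacian// scaler0.
  apply: (@mup0_char_poly_gt0 _ _ _ (row_mx (const_mx 1) 0)).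
    apply: contraNneq one0 => /(congr1 lsubmx).
    by rewrite row_mxKl linear0 => ->.
  rewrite mul_row_block !mul0mx !addr0 -!scalemxAr const_mul_laplacian//.
  by rewrite !scaler0 row_mx0.
by case: stA => ->.
Qed.

Hypothesis g_sum_gt0 : 0 < \sum_i g i.

(** A positive sum of the [g i] forces the index set to be nonempty. *)
Lemma kP_sum_gt0 : 0 < \sum_i kP i.
Proof.
have [i _ gi] : exists2 i, true & 0 < g i.
  apply: contrapT => no; move: g_sum_gt0; rewrite big1 ?ltxx// => i _.
  by apply/eqP; rewrite eq_le g_ge0 andbT leNgt; apply/negP => gi; apply: no; exists i.
by rewrite (bigD1 i)//= ltr_wpDr ?sumr_ge0// => j _; rewrite ltW.
Qed.

(** For [x = (a, b, v)], the second block row makes [a + b - v] a constant [al]. Summing the third,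
    [LR v = KP (a + b - v)], gives [al = 0], so [v] is a constant [be]; summing the first gives
    [be = 0]. *)
Lemma system_matrix_ker (x : 'cV[R]_(n + (n + n))) :
  A *m x = 0 ->
  dsubmx (dsubmx x) = 0 /\ usubmx x + usubmx (dsubmx x) = 0.
Proof.
rewrite -[x]vsubmxK -[dsubmx x]vsubmxK !(col_mxKu, col_mxKd).
move: (usubmx x) (usubmx (dsubmx x)) (dsubmx (dsubmx x)) => a b v.
rewrite system_matrix_mul -!col_mx0 => /eq_col_mx[r1 /eq_col_mx[r2 r3]].
have [|al abv] := @laplacian_ker _ _ _ _ cec pc (a + b - v).
  by move/eqP: r2; rewrite scaler_eq0 oppr_eq0 gt_eqF//= => /eqP.
have LRv i : (LR *m v) i 0 = kP i * al.
  have /matrixP/(_ i 0) := r3; rewrite diagm_mulE abv [X in _ * X]mxE.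
  rewrite [X in _ * (_ + X)]mxE diagm_mulE !mxE => /eqP.
  by rewrite mulf_eq0 gt_eqF//= subr_eq0 => /eqP.
have al0 : al = 0.
  apply: (sum_mulr_eq0 kP_sum_gt0); rewrite -[RHS](sum_laplacian_mul ce pw v).
  by apply: eq_bigr => i _; rewrite LRv.
have [|be vbe] := @laplacian_ker _ _ _ _ ce pw v.
  by apply/matrixP => i j; rewrite ord1 LRv al0 mulr0 mxE.
have be0 : be = 0.
  apply: (sum_mulr_eq0 g_sum_gt0).
  rewrite -[RHS](mulr0 (- delta)) -[X in _ = _ * X](sum_laplacian_mul cec pc a).
  rewrite mulr_sumr; apply: eq_bigr => i _; apply/eqP; rewrite eq_sym -subr_eq0.
  have /matrixP/(_ i 0) := r1; rewrite mxE [X in X + _]mxE [X in _ + X]mxE.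
  by rewrite diagm_mulE vbe !mxE => ->.
have v0 : v = 0 by rewrite vbe be0; apply/matrixP => i j; rewrite !mxE.
split=> //; move: abv; rewrite v0 subr0 al0 => ->.
by apply/matrixP => i j; rewrite !mxE.
Qed.

(** The first two block columns give [a Lc = 0], so [a] is constant; the third reduces to
    [a G = - v E LR], whose sum forces [a = 0]. Then [v E] is constant, and summing
    [v E KP = gamma b Lc] makes it vanish. *)
Lemma system_matrix_ker_row (a b v : 'rV[R]_n) :
  row_mx a (row_mx b v) *m A = 0 -> a = 0 /\ v = 0.
Proof.
rewrite mul_system_matrix -!row_mx0 => /eq_row_mx[r1 /eq_row_mx[r2 r3]].
have [|al aal] := @laplacian_ker_row _ _ _ _ cec pc a.
  by move/eqP: r1; rewrite r2 addr0 scaler_eq0 oppr_eq0 gt_eqF//= => /eqP.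
have vLc : v *m diagm E *m diagm kP = gamma *: (b *m Lc).
  by apply/eqP; rewrite -subr_eq0 r2.
have {}r3 : a *m diagm g = - (v *m diagm E *m LR).
  move: r3; rewrite vLc opprD addrACA subrr addr0 -opprD => /eqP.
  by rewrite oppr_eq0 addr_eq0 => /eqP.
have row_sum (l : 'rV[R]_n) : \sum_i l 0 i = (l *m const_mx 1 : 'M[R]_1) 0 0.
  by rewrite mxE; apply: eq_bigr => i _; rewrite mxE mulr1.
have a0 : al = 0.
  apply: (sum_mulr_eq0 g_sum_gt0).
  transitivity (\sum_i (a *m diagm g) 0 i).
    by apply: eq_bigr => i _; rewrite mul_diagmE aal mxE mulrC.
  rewrite row_sum r3 mulNmx -(mulmxA _ LR) /LR laplacian_mul_const//.
  by rewrite mulmx0 oppr0 mxE.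
have az : a = 0 by rewrite aal a0; apply/matrixP => i j; rewrite !mxE.
have [|be vbe] := @laplacian_ker_row _ _ _ _ ce pw (v *m diagm E).
  by apply/eqP; rewrite -oppr_eq0 -r3 az mul0mx.
have be0 : be = 0.
  apply: (sum_mulr_eq0 kP_sum_gt0).
  transitivity (\sum_i (v *m diagm E *m diagm kP) 0 i).
    by apply: eq_bigr => i _; rewrite mul_diagmE vbe mxE mulrC.
  rewrite row_sum vLc -scalemxAl -mulmxA /Lc laplacian_mul_const//.
  by rewrite mulmx0 scaler0 mxE.
split=> //; apply/matrixP => i j; rewrite ord1.
have /matrixP/(_ 0 j) := vbe; rewrite mul_diagmE be0 !mxE => /eqP.
by rewrite mulf_eq0 (gt_eqF (E_gt0 j)) orbF => /eqP.
Qed.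

(** The right-hand side is the opposite of the constant forcing term of the closed loop. Its middle
    block is 0, the only block a left null vector of [A] can see. *)
Lemma closed_loop_equilibrium (Iinj Vnom : 'cV[R]_n) :
  exists a b v : 'cV[R]_n,
    A *m col_mx a (col_mx b v) =
      - col_mx (diagm g *m Vnom) (col_mx 0 (diagm E *m Iinj)).
Proof.
have [x Ax] : exists x, A *m x =
    - col_mx (diagm g *m Vnom) (col_mx 0 (diagm E *m Iinj)).
  apply: mulmx_solvable => l; rewrite -[l]hsubmxK -[rsubmx l]hsubmxK.
  move/system_matrix_ker_row => [-> ->].
  by rewrite mulmxN !mul_row_col !mul0mx mulmx0 !addr0 oppr0.
by exists (usubmx x), (usubmx (dsubmx x)), (dsubmx (dsubmx x)); rewrite !vsubmxK.
Qed.

End closed_loop.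

(** * Convergence of the closed loop and optimality of the limit *)

(** Since [P = Q A] for some [Q], each coordinate of [P y] is a row of [Q] applied to [A y], which
    decays. *)
Lemma stable_observable_cvg0 (R : realType) (m p : nat) (A : 'M[R]_m)
    (P : 'M[R]_(p, m)) (y : R -> 'cV[R]_m) :
  stable_but_simple_zero A ->
  (forall t : R, 0 < t ->
     forall i, is_derive t 1 (fun s => y s i 0) ((A *m y t) i 0)) ->
  (forall x : 'cV[R]_m, A *m x = 0 -> P *m x = 0) ->
  P *m y t @[t --> +oo] --> (0 : 'cV[R]_p).
Proof.
move=> stA dy /mulmx_factor_of_ker[Q ->]; apply: cvg_mx => i j.
rewrite ord1 mxE.
have -> : (fun t => (Q *m A *m y t) i 0) = (fun t => (row i Q *m (A *m y t)) 0 0).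
by apply/funext => t; rewrite -mulmxA -row_mul [RHS]mxE.
exact: stable_but_simple_zero_cvg0.
Qed.

Theorem theorem10 (R : realType) (n : nat)
    (e : rel 'I_n) (r : 'I_n -> 'I_n -> R) (C : 'I_n -> R)
    (ec : rel 'I_n) (c : 'I_n -> 'I_n -> R)
    (Iinj Vnom : 'cV[R]_n) (kP kV f g : 'I_n -> R) (gamma delta : R)
    (u V Vh Vb : R -> 'cV[R]_n)
    (LR := laplacian e (fun i j => (r i j)^-1)) (Lc := laplacian ec c)
    (E := diagm (fun i => (C i)^-1)) :
  connected_simple_graph e -> positive_edge_weights e r ->
  connected_simple_graph ec -> positive_edge_weights ec c ->
  (forall i, 0 < C i) -> (forall i, 0 < kP i) ->
  0 < gamma -> 0 < delta ->
  (forall i, 0 < f i) -> (forall i, 0 <= g i) ->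
  mtdc_dynamics e r C Iinj u V ->
  controller_III Lc (diagm kP) (diagm kV) gamma delta Vnom u V Vh Vb ->
  stable_but_simple_zero
    (system_matrix LR Lc E (diagm kP) (diagm kV) gamma delta) ->
  diagm kP = invmx (diagm f) -> diagm kV = diagm g ->
  objective1 LR Iinj Vnom f g u V.
Proof.
move=> ce pr cec pc C0 kP0 gamma0 delta0 f0 g0 dynV ctrl stA kPf kVg.
have {}kVg := diagm_inj kVg; subst kV.
have fkP i : f i * kP i = 1.
  (* [invmx] is a true inverse only on invertible matrices, so the determinant of F is checked to be
     nonzero. *)
  have fu : diagm f \in unitmx.
    rewrite unitmxE det_diag unitfE; apply/prodf_neq0 => j _.
    by rewrite mxE gt_eqF.
  have /matrixP/(_ i i) := mulmxV fu; rewrite -kPf mul_diag_mx !mxE eqxx.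
  by rewrite !mulr1n.
have pw := positive_edge_weightsV pr.
have Ei0 i : 0 < (C i)^-1 by rewrite invr_gt0.
have gs0 := stable_sum_gain_gt0 cec pc g0 stA.
have [a [b [v eqx]]] :=
  closed_loop_equilibrium gamma ce pw cec pc Ei0 kP0 delta0 g0 gs0 Iinj Vnom.
set A := system_matrix _ _ _ _ _ _ _ in stA eqx.
(* The control law evaluated at the equilibrium [(a, b, v)]. *)
pose us := diagm kP *m (a + b - v).
move: (eqx); rewrite system_matrix_mul !opp_col_mx oppr0.
move=> /eq_col_mx[eq1 /eq_col_mx[eq2 eq3]].
(* The constant [al] is the common marginal cost: [f i * us i 0 = al] because [f i * kP i = 1]. *)
have [|al abv] := @laplacian_ker _ _ _ _ cec pc (a + b - v).
  by move/eqP: eq2; rewrite scaler_eq0 oppr_eq0 gt_eqF//= => /eqP.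
have eqv : LR *m v = Iinj + us.
  apply/matrixP => i j; rewrite ord1.
  have /matrixP/(_ i 0) := eq3; rewrite diagm_mulE [RHS]mxE diagm_mulE -mulrN.
  move/(mulfI (lt0r_neq0 (Ei0 i))); rewrite -/us mxE [X in _ + X]mxE => us_i.
  by rewrite [RHS]mxE -[Iinj i 0]opprK -us_i opprB subrK.
(* First block row of the equilibrium equation, summed over the buses. *)
have gv : \sum_i g i * (v i 0 - Vnom i 0) = 0.
  rewrite -[RHS](mulr0 (- delta)) -[X in _ = _ * X](sum_laplacian_mul cec pc a).
  rewrite mulr_sumr; apply: eq_bigr => i _.
  have /matrixP/(_ i 0) := eq1; rewrite mxE [X in X + _]mxE [X in _ + X]mxE diagm_mulE.
  rewrite [RHS]mxE diagm_mulE => h.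
  by rewrite mulrBr -h -/Lc; ring.
have [optv uniq_us] : optimal_pair LR Iinj f us v /\
    forall u' V', optimal_pair LR Iinj f u' V' -> us = u'.
  apply: (@optimal_pair_unique _ _ _ _ _ _ _ _ al) => // i.
  by rewrite diagm_mulE abv mxE mulrA fkP mul1r.
pose x t := col_mx (Vb t) (col_mx (Vh t) (V t)).
pose y t := x t - col_mx a (col_mx b v).
have dy (t : R) : 0 < t -> forall i, is_derive t 1 (fun s => y s i 0) ((A *m y t) i 0).
  move=> t0 i.
  have [ut dVh dVb] := ctrl t t0.
  have [dV1 dV2] := dynV t t0.
  suff dx : is_derive t 1 (fun s => x s i 0) ((A *m y t) i 0).
    rewrite -[X in is_derive _ _ _ X]subr0.
    rewrite (_ : (fun s => y s i 0)
      = (fun s => x s i 0) - cst (col_mx a (col_mx b v) i 0)).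
      exact: is_deriveB.
    by apply/funext => s; rewrite /y mxE [X in _ + X]mxE.
  rewrite mulmxBr eqx opprK system_matrix_mul !add_col_mx addr0.
  case: (split_ordP i) => {}i ->.
    rewrite col_mxEu.
    rewrite (_ : (fun s => _) = (fun s => Vb s i 0)); last first.
      by apply/funext => s; rewrite /x col_mxEu.
    apply: is_derive_coord; apply: is_derive_eq.
    by rewrite mulmxBr opprB scaleNr [LHS]addrC [LHS]addrA [LHS]addrAC.
  rewrite col_mxEd; case: (split_ordP i) => {}i ->.
    rewrite col_mxEu.
    rewrite (_ : (fun s => _) = (fun s => Vh s i 0)); last first.
      by apply/funext => s; rewrite /x col_mxEd col_mxEu.
    apply: is_derive_coord; apply: is_derive_eq.
    by rewrite (addrC (Vh t)).
  rewrite col_mxEd.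
  rewrite (_ : (fun s => _) = (fun s => V s i 0)); last first.
    by apply/funext => s; rewrite /x !col_mxEd.
  have -> : (E *m (diagm kP *m (Vb t + Vh t - V t) - LR *m V t) + E *m Iinj) i 0
      = (derive1 V t) i 0.
    have /= LRE := laplacian_mulE (fun i j => (r i j)^-1) ce (V t) i.
    apply: (mulfI (lt0r_neq0 (C0 i))); rewrite dV2 -LRE -/LR.
    rewrite -mulmxDr diagm_mulE mulrA divff ?gt_eqF// mul1r ut.
    have -> : V t - Vh t - Vb t = - (Vb t + Vh t - V t).
      by rewrite opprB opprD addrA addrAC.
    rewrite mulmxN opprK !mxE; ring.
  by rewrite derive1E; apply: is_derive_coord; apply: DeriveDef.
(* [PV] and [Pu] read the voltage and the control input off the state [(Vb, Vh, V)]. *)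
pose PV : 'M[R]_(n, n + (n + n)) := row_mx 0 (row_mx 0 1%:M).
pose Pu : 'M[R]_(n, n + (n + n)) := diagm kP *m row_mx 1%:M (row_mx 1%:M (- 1%:M)).
have PVE (s1 s2 s3 : 'cV[R]_n) : PV *m col_mx s1 (col_mx s2 s3) = s3.
  by rewrite !mul_row_col !mul0mx !add0r mul1mx.
have PuE (s1 s2 s3 : 'cV[R]_n) :
    Pu *m col_mx s1 (col_mx s2 s3) = diagm kP *m (s1 + s2 - s3).
  by rewrite -mulmxA !mul_row_col !mul1mx mulNmx mul1mx addrA.
have kerA (z : 'cV[R]_(n + (n + n))) : A *m z = 0 ->
    dsubmx (dsubmx z) = 0 /\ usubmx z + usubmx (dsubmx z) = 0.
  exact: (system_matrix_ker ce pw cec pc Ei0 kP0 gamma0 g0 gs0).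
have cvgV : PV *m y t @[t --> +oo] --> (0 : 'cV[R]_n).
  apply: (stable_observable_cvg0 stA dy) => z /kerA[z0 _].
  by rewrite -[z]vsubmxK -[dsubmx z]vsubmxK PVE z0.
have cvgu : Pu *m y t @[t --> +oo] --> (0 : 'cV[R]_n).
  apply: (stable_observable_cvg0 stA dy) => z /kerA[z0 z1].
  by rewrite -[z]vsubmxK -[dsubmx z]vsubmxK PuE z0 z1 subr0 mulmx0.
exists us, v; split => //.
- by split=> [|u' [V' /uniq_us]]//; exists v.
- rewrite -[us]add0r.
  have : Pu *m y t + us @[t --> +oo] --> 0 + us by apply: cvgD => //; exact: cvg_cst.
  (* The control law holds at positive times only, so [u] agrees with [Pu *m y t + us] eventually;
     the analogous identity for [V] below holds at every time. *)
  apply: cvg_trans; apply: near_eq_cvg; near=> t.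
  have t0 : 0 < t by near: t; apply: nbhs_pinfty_gt; rewrite num_real.
  have [-> _ _] := ctrl t t0.
  rewrite mulmxBr !PuE -/us subrK -mulmxN; congr (_ *m _).
  by rewrite !opprB addrA addrAC (addrC (Vb t)).
- rewrite -[v]add0r.
  rewrite (_ : V = (fun t => PV *m y t + v)).
    by apply: cvgD => //; exact: cvg_cst.
  by apply/funext => t; rewrite mulmxBr !PVE subrK.
- move=> W [eqW _].
  (* Two optimal voltage vectors have the same image under [LR], hence differ by a constant. *)
  have [|be Wv] := @laplacian_ker _ _ _ _ ce pw (W - v).
    by rewrite mulmxBr eqW eqv subrr.
  by rewrite -[W](subrK v) addrC Wv voltage_deviation_shift_ge.
Unshelve. all: by end_near. Qed.
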